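(* Let $T$ be a positive random variable with characteristic function $\Phi(\omega)=\mathbb E[e^{i\omega T}]$, and let $\Delta>0$. Then $$\sup_{|\omega|\ge\Delta}|\Phi(\omega)|\ \ge\ e^{-\Delta\langle T\rangle\pi/2}.$$
   Context: $\langle T\rangle=\mathbb E[T]$ (if infinite, the bound is trivial). *)

(* Defs.v *)
From HB Require Import structures.
From mathcomp Require Import all_boot all_order all_algebra.
From mathcomp Require Import all_classical all_reals all_analysis.
Set Implicit Arguments. Unset Strict Implicit. Unset Printing Implicit Defensive.
Import Order.TTheory GRing.Theory Num.Theory.
Local Open Scope ring_scope.

(* Characteristic function Phi(w) = E[exp(i w X)], written via its real and
   imaginary parts: Re Phi(w) = E[cos(w X)], Im Phi(w) = E[sin(w X)]
   (both integrands are bounded measurable, hence integrable). *)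
Definition charfun_re (d : measure_display) (T : measurableType d)
  (R : realType) (P : probability T R) (X : T -> R) (w : R) : R :=
  Rintegral P setT (fun x => cos (w * X x)).

Definition charfun_im (d : measure_display) (T : measurableType d)
  (R : realType) (P : probability T R) (X : T -> R) (w : R) : R :=
  Rintegral P setT (fun x => sin (w * X x)).

Definition charfun_abs (d : measure_display) (T : measurableType d)
  (R : realType) (P : probability T R) (X : T -> R) (w : R) : R :=
  Num.sqrt (charfun_re P X w ^+ 2 + charfun_im P X w ^+ 2).

(* Main.v *)
Require Import Defs.
From HB Require Import structures.
From mathcomp Require Import all_boot all_order all_algebra.
From mathcomp Require Import ring lra.
From mathcomp Require Import all_classical all_reals all_analysis.
From mathcomp Require Import measurable_realfun.
Import Order.TTheory GRing.Theory Num.Theory.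
Import numFieldNormedType.Exports.
Local Open Scope classical_set_scope.
Local Open Scope ring_scope.

Set Implicit Arguments.
Unset Strict Implicit.

(* The function [Phi (x + i y) = E[exp (i (x + i y) X)]] is holomorphic and bounded
   by 1 on the upper half plane since [X > 0].  If [|Phi| <= exp (- lam)] on
   [{x | D <= |x|}] and [h] is the harmonic measure of that set, comparing
   boundary values gives [|Phi| <= exp (- lam h)].  On the imaginary axis,
   [Phi (i y) >= 1 - y E[X]] while [h (i y) = (2 / pi) atan (y / D)], and letting
   [y] tend to 0 yields [lam <= D E[X] pi / 2].

   The comparison only needs a second-derivative maximum principle in two real
   variables, applied to [|Phi|^2 exp (2 lam h)] minus a small multiple of a
   strictly superharmonic function that grows at infinity; [h] is smoothed by
   slightly raising the half plane and enlarging [D] to [a]. *)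

(** * Calculus of first and second derivatives at a point *)

Section second_order_jets.
Context {R : realType}.
Implicit Types (f g : R -> R) (c : R).

(** Explicit values allow a Laplacian to be assembled by the rules below and then matched by [ring]
    or [field] through [jet2_eq]. A derivative on a neighbourhood is the least that gives the second
    derivative at [c] a meaning. *)
Definition jet2 f c (a b : R) := exists2 df : R -> R,
  (\forall t \near c, is_derive (t : R) (1 : R) f (df t)) &
  df c = a /\ is_derive c 1 df b.

Lemma jet2_eq f c a b p q : jet2 f c a b -> a = p -> b = q ->
  jet2 f c p q.
Proof. by move=> ? <- <-. Qed.

Lemma jet2_derive f c a b : jet2 f c a b -> is_derive c 1 f a.
Proof. by case=> df /nbhs_singleton ? [<-]. Qed.

Lemma jet2_cst (k c : R) : jet2 (fun=> k) c 0 0.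
Proof.
exists (fun=> 0); last by split => //; exact: is_derive_cst.
by near=> t; exact: is_derive_cst.
Unshelve. all: by end_near. Qed.

Lemma jet2_id c : jet2 id c 1 0.
Proof.
exists (fun=> 1); last by split => //; exact: is_derive_cst.
by near=> t; exact: is_derive_id.
Unshelve. all: by end_near. Qed.

Lemma jet2D f g c a b p q : jet2 f c a b -> jet2 g c p q ->
  jet2 (fun t => f t + g t) c (a + p) (b + q).
Proof.
move=> [df fdf [<- d2f]] [dg gdg [<- d2g]]; exists (fun t => df t + dg t).
  by near=> t; apply: is_deriveD; near: t.
by split => //; exact: is_deriveD.
Unshelve. all: by end_near. Qed.

Lemma jet2M f g c a b p q : jet2 f c a b -> jet2 g c p q ->
  jet2 (fun t => f t * g t) c (a * g c + f c * p)
    (b * g c + a * p *+ 2 + f c * q).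
Proof.
move=> F G; have Df := jet2_derive F; have Dg := jet2_derive G.
move: F G => [df fdf [? d2f]] [dg gdg [? d2g]]; subst a p.
exists (fun t => df t * g t + f t * dg t).
  near=> t; have ft : is_derive t 1 f (df t) by near: t.
  have gt : is_derive t 1 g (dg t) by near: t.
  by apply: is_derive_eq (is_deriveM ft gt) _; rewrite /GRing.scale/=; ring.
split => //.
apply: is_derive_eq (is_deriveD (is_deriveM d2f _) (is_deriveM _ d2g)) _.
by rewrite /GRing.scale/=; ring.
Unshelve. all: by end_near. Qed.

Lemma jet2N f c a b : jet2 f c a b -> jet2 (fun t => - f t) c (- a) (- b).
Proof.
move=> [df fdf [<- d2f]]; exists (fun t => - df t).
  by near=> t; apply: is_deriveN; near: t.
by split => //; exact: is_deriveN.
Unshelve. all: by end_near. Qed.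

Lemma jet2B f g c a b p q : jet2 f c a b -> jet2 g c p q ->
  jet2 (fun t => f t - g t) c (a - p) (b - q).
Proof. by move=> F /jet2N; exact: jet2D. Qed.

Lemma jet2_scale k f c a b : jet2 f c a b ->
  jet2 (fun t => k * f t) c (k * a) (k * b).
Proof. by move=> /(jet2M (jet2_cst k c))/jet2_eq; apply; ring. Qed.

Lemma jet2_comp f g c a b p q : jet2 g c p q -> jet2 f (g c) a b ->
  jet2 (fun t => f (g t)) c (a * p) (b * p ^+ 2 + a * q).
Proof.
move=> G F; have Df := jet2_derive F; have Dg := jet2_derive G.
move: F G => [df fdf [? d2f]] [dg gdg [? d2g]]; subst a p.
have gc : {for c, continuous g}.
  by apply: differentiable_continuous; apply/derivable1_diffP; exact: ex_derive.
exists (fun t => df (g t) * dg t).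
  near=> t; have ft : is_derive (g t) 1 f (df (g t)).
    by near: t; exact: (gc _ fdf).
  have gt : is_derive t 1 g (dg t) by near: t.
  exact: is_derive1_comp.
split => //.
apply: is_derive_eq (is_deriveM (is_derive1_comp d2f Dg) d2g) _.
by rewrite /GRing.scale/=; ring.
Unshelve. all: by end_near. Qed.

Lemma jet2_expR c : jet2 expR c (expR c) (expR c).
Proof.
exists expR; last by split => //; exact: is_derive_expR.
by near=> t; exact: is_derive_expR.
Unshelve. all: by end_near. Qed.

Lemma jet2_inv c : c != 0 -> jet2 GRing.inv c (- c ^- 2) (2 * c ^- 3).
Proof.
move=> c0; exists (fun t => - t ^- 2).
  near=> t.
  have t0 : t != 0.
    near: t; have := @open_neq R 0; rewrite openE => /(_ c); exact.
  apply: is_derive_eq (is_deriveV (f := id) t0 _) _.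
  by rewrite /GRing.scale/= mulr1.
split => //.
have c20 : c ^+ 2 != 0 by rewrite expf_neq0.
have D : is_derive c (1 : R) (fun t : R => t ^+ 2) (2 * c).
  apply: is_derive_eq (is_deriveX 2 _) _.
  by rewrite /GRing.scale/= mulr1 expr1.
apply: is_derive_eq (is_deriveN (is_deriveV (f := fun t => t ^+ 2) c20 D)) _.
by rewrite /GRing.scale/=; field.
Unshelve. all: by end_near. Qed.

Lemma jet2_ln c : 0 < c -> jet2 (@ln R) c c^-1 (- c ^- 2).
Proof.
move=> c0; exists GRing.inv.
  near=> t; apply: is_derive1_ln.
  by near: t; exact: lt_nbhsr.
split => //.
apply: is_derive_eq (is_deriveV (f := id) (lt0r_neq0 c0) _) _.
by rewrite /GRing.scale/= mulr1.
Unshelve. all: by end_near. Qed.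

Lemma jet2_atan c : jet2 (@atan R) c (1 + c ^+ 2)^-1 (- (2 * c) / (1 + c ^+ 2) ^+ 2).
Proof.
exists (fun t => (1 + t ^+ 2)^-1).
  by near=> t; exact: is_derive1_atan.
split => //.
have c0 : 1 + c ^+ 2 != 0 by rewrite gt_eqF// ltr_pwDl// sqr_ge0.
have D : is_derive c (1 : R) (fun t : R => 1 + t ^+ 2) (2 * c).
  apply: is_derive_eq (is_deriveD (is_derive_cst _ _ _) (is_deriveX 2 _)) _.
  by rewrite /GRing.scale/= mulr1 expr1 add0r.
apply: is_derive_eq (is_deriveV (f := fun t => 1 + t ^+ 2) c0 D) _.
by rewrite /GRing.scale/=; field.
Unshelve. all: by end_near. Qed.

(** Otherwise [f'] vanishes at [c] and is positive just to its right, so the mean value theorem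
    yields a larger value there. *)
Lemma jet2_local_max f c a b : jet2 f c a b ->
  (\forall t \near c, f t <= f c) -> b <= 0.
Proof.
move=> [df fdf [df1 d2f]] fmax; rewrite leNgt; apply/negP => b_gt0.
have /nbhs_ballP[e /= e0 He] : \forall t \near c,
  is_derive (t : R) (1 : R) f (df t) /\ f t <= f c by near=> t; split; near: t.
have cI : c \in `]c - e, c + e[ by rewrite in_itv/=; apply/andP; split; lra.
have bI t : t \in `]c - e, c + e[ -> ball c e t.
  by rewrite in_itv/= /ball/= ltr_distlC.
have df0 : df c = 0.
  have [D _] := He c (bI _ cI).
  have D0 : is_derive c 1 f 0.
    apply: (@derive1_at_max R f (c - e) (c + e)) => // [|t /bI/He[Dt _]|t /bI/He[]//].
      by lra.
    exact: ex_derive.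
  by rewrite -(derive_val (is_derive := D)) (derive_val (is_derive := D0)).
(* The slope [q] satisfies [df t - df c = q t * (t - c)], is continuous at [c], and equals [b > 0]
   there, which fixes the sign of [df] near [c]. *)
have /is_derive1_caratheodory[q [dfE qc qE]] := d2f.
have /nbhs_ballP[e' /= e'0 He'] : \forall t \near c, 0 < q t.
  by apply: (cvgr_gt (q c) qc); rewrite qE.
pose r := c + Num.min e e' / 2.
have m0 : 0 < Num.min e e' by rewrite lt_min e0 e'0.
have [me me'] : Num.min e e' <= e /\ Num.min e e' <= e'.
  by rewrite !ge_min !lexx orbT.
have cb : c < r by rewrite /r; lra.
have bb : r \in `]c - e, c + e[.
  by rewrite in_itv/= /r; apply/andP; split; lra.
have inI t : t \in `[c, r] -> t \in `]c - e, c + e[.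
  by rewrite !in_itv/= /r => /andP[? ?]; apply/andP; split; lra.
have [||s] := @MVT R f df c r cb.
- move=> t tI; have [] := He t (bI _ (inI _ _)) => //.
  exact: subset_itv_oo_cc.
- apply: derivable_within_continuous => t tI.
  by have [Dt _] := He t (bI _ (inI _ tI)); exact: ex_derive.
rewrite in_itv/= => /andP[cs sb] fE.
have [_ fb] := He r (bI _ bb).
have : 0 < df s * (r - c).
  rewrite mulr_gt0 ?subr_gt0//.
  have := dfE s; rewrite df0 subr0 => ->; rewrite mulr_gt0 ?subr_gt0//.
  apply: He'; rewrite /ball/= ltr_distlC; apply/andP; split; first lra.
  by move: sb; rewrite /r; lra.
by rewrite -fE; lra.
Unshelve. all: by end_near. Qed.

End second_order_jets.

(** * Maximum principle on the half plane *)

(* The strict inequality [0 < fxx + fyy] forbids interior maxima, since there both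
   pure second derivatives are nonpositive. *)
Lemma half_plane_max_principle {R : realType} (W : R -> R -> R) (C rho : R) :
  continuous (fun p : R * R => W p.1 `|p.2|) ->
  (forall x, W x 0 <= C) ->
  (forall x y, 0 <= y -> rho <= `|x| \/ rho <= y -> W x y <= C) ->
  (forall x y, 0 < y -> exists fx fxx fy fyy, [/\ jet2 (W ^~ y) x fx fxx,
     jet2 (W x) y fy fyy & 0 < fxx + fyy]) ->
  forall x y, 0 <= y -> W x y <= C.
Proof.
move=> cW W0 Winf Wsub x y y0.
have [rx|xr] := leP rho `|x|; first by apply: Winf => //; left.
have [ry|yr] := leP rho y; first by apply: Winf => //; right.
pose K : set (R * R) := `[- rho, rho]%classic `*` `[0, rho]%classic.
have Kxy : K (x, y).
  by split => /=; rewrite in_itv/= ?y0 ?(ltW yr)// -ler_norml (ltW xr).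
have cK : compact K by apply: compact_setX; exact: segment_compact.
have K0 : K !=set0 by exists (x, y).
(* Even reflection in the second variable makes the function continuous on the whole plane, so it
   attains its maximum on the rectangle [K]. *)
have [|[a b] /set_mem[/=]] := compact_EVT_max (f := fun p : R * R => W p.1 `|p.2|) K0 cK.
  exact: continuous_subspaceT.
rewrite !in_itv/= => /andP[ra ar] /andP[b0 br] Kmax.
have WK s t : `|s| <= rho -> 0 <= t <= rho -> W s t <= W a b.
  move=> sr /andP[t0 tr].
  have /= := Kmax (s, t); rewrite !ger0_norm//; apply.
  by rewrite inE; split => /=; rewrite in_itv/= -?ler_norml// t0.
apply: (@le_trans _ _ (W a b)); first by apply: WK; [exact: ltW|rewrite y0 ltW].
have [->//|b_neq0] := eqVneq b 0.
have {b_neq0}b_gt0 : 0 < b by rewrite lt_neqAle eq_sym b_neq0.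
have [ab|ab] := leP rho `|a|; first by apply: Winf => //; left.
have [rb|{}br] := leP rho b; first by apply: Winf => //; right.
have [fx [fxx [fy [fyy [Jx Jy]]]]] := Wsub a b b_gt0.
have fxx0 : fxx <= 0.
  apply: jet2_local_max Jx _; near=> t; apply: WK; last by rewrite b0 ltW.
  apply: ltW; near: t; apply: (cvgr_lt `|a|) => //.
  exact: (@norm_continuous R R a).
have fyy0 : fyy <= 0.
  apply: jet2_local_max Jy _; near=> t; apply: WK; first exact: ltW.
  apply/andP; split; apply: ltW; near: t; [exact: lt_nbhsr|exact: lt_nbhsl].
by rewrite ltNge -oppr_ge0 opprD addr_ge0// oppr_ge0.
Unshelve. all: by end_near. Qed.

(** * Differentiation under the integral and elementary real estimates *)

Lemma is_derive_Rintegral {R : realType} (d : measure_display)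
    (Y : measurableType d) (mu : {measure set Y -> \bar R})
    (f df : R -> Y -> R) (G : Y -> R) (u v a : R) :
  u < a < v ->
  (forall x, u < x < v -> mu.-integrable setT (EFin \o f x)) ->
  (forall x y, u < x < v -> is_derive x 1 (f ^~ y) (df x y)) ->
  mu.-integrable setT (EFin \o G) ->
  (forall x y, u < x < v -> `|df x y| <= G y) ->
  is_derive a 1 (fun x => \int[mu]_y f x y) (\int[mu]_y df a y).
Proof.
move=> auv intf fdf intG dfG.
have G0 y : 0 <= G y by exact: le_trans (normr_ge0 _) (dfG a y auv).
have d1E x y : u < x < v -> partial1of2 f x y = df x y.
  move=> /(fdf x y) D; rewrite partial1of2E.
  exact: (derive_val (is_derive := D)).
have aI : `]u, v[%classic a by rewrite /= in_itv.
have Hf x : `]u, v[%classic x -> mu.-integrable setT (EFin \o f x).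
  by rewrite /= in_itv; exact: intf.
have Hd x y : `]u, v[%classic x -> setT y -> derivable (f ^~ y) x 1.
  by rewrite /= in_itv/= => /(fdf x y) D _; exact: ex_derive.
have HG x y : `]u, v[%classic x -> setT y -> `|partial1of2 f x y| <= G y.
  by rewrite /= in_itv/= => xI _; rewrite d1E// dfG.
apply: DeriveDef.
  exact: derivable_under_integral measurableT _ _ _ aI Hf Hd _ G0 intG HG.
rewrite -derive1E.
rewrite (differentiation_under_integral measurableT aI Hf Hd G0 intG HG).
by apply: eq_Rintegral => y _; rewrite d1E.
Qed.

Section real_bounds.
Context {R : realType}.
Implicit Types (a b t x y : R).

Lemma dist_cos_le a b : `|cos a - cos b| <= `|a - b|.
Proof.
wlog ab : a b / a <= b.
  move=> H; have [/H//|/ltW/H] := leP a b.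
  by rewrite distrC (distrC b).
have cc : {within `[a, b], continuous (@cos R)}.
  by apply: continuous_subspaceT; exact: continuous_cos.
have [c _ E] := MVT_segment ab (fun x _ => is_derive_cos x) cc.
rewrite distrC E normrM normrN (distrC b) ler_piMl//.
by rewrite ler_norml sin_geN1 sin_le1.
Qed.

Lemma dist_expRN_le a b : 0 <= a -> 0 <= b ->
  `|expR (- a) - expR (- b)| <= `|a - b|.
Proof.
wlog ab : a b / a <= b.
  move=> H a0 b0; have [ab|/ltW ba] := leP a b; first exact: H.
  by rewrite distrC (distrC a) H.
move=> a0 b0.
rewrite ger0_norm ?subr_ge0 ?ler_expR ?lerN2// distrC ger0_norm ?subr_ge0//.
have -> : - b = - a + (a - b) by ring.
rewrite expRD -{1}[expR (- a)]mulr1 -mulrBr.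
have E1 : expR (- a) <= 1 by rewrite expR_le1 oppr_le0.
have E2 := expR_ge1Dx (a - b).
have E3 : expR (a - b) <= 1 by rewrite expR_le1 subr_le0.
by apply: le_trans (ler_piMl _ E1) _; lra.
Qed.

(** Half of the decay rate absorbs one factor [t], because [y / 2 * t <= expR (y / 2 * t)]; the
    other half is left to the induction. These bounds are the dominating constants for the
    moments. *)
Lemma exprn_expRN_bounded k y : 0 < y ->
  exists C, forall t, 0 <= t -> t ^+ k * expR (- (y * t)) <= C.
Proof.
elim: k y => [|k IH] y y0.
  exists 1 => t t0; rewrite expr0 mul1r expR_le1 oppr_le0.
  by rewrite mulr_ge0// ltW.
have y20 : 0 < y / 2 by lra.
have [C HC] := IH _ y20; exists ((y / 2)^-1 * C) => t t0.
have -> : - (y * t) = - (y / 2 * t) - (y / 2 * t) by field.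
rewrite expRD exprS mulrACA; apply: ler_pM => //.
- by rewrite mulr_ge0// expR_ge0.
- by rewrite mulr_ge0 ?exprn_ge0 ?expR_ge0.
- rewrite expRN ler_pdivrMr ?expR_gt0// -ler_pdivrMl ?invr_gt0// invrK.
  by apply: le_trans (expR_ge1Dx _); rewrite lerDr.
- exact: HC.
Qed.

End real_bounds.

(** * Real and imaginary parts of [Phi] on the half plane, and their derivatives *)

Section damped_moments.
Context (d : measure_display) (T : measurableType d) (R : realType)
  (P : probability T R) (X : {RV P >-> R}).
Hypothesis X_ge0 : forall w, 0 <= X w.

(* The phase [th] treats cosine ([th = 0]) and sine ([th = - pi / 2]) moments
   uniformly: differentiating in [x] shifts [th] by [pi / 2]. *)
Definition damped_moment k (th x y : R) : R :=
  \int[P]_w (X w ^+ k * expR (- (y * X w)) * cos (x * X w + th)).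

Local Notation phi := damped_moment.

Lemma bounded_integrable (f : R -> R) C : continuous f ->
  (forall w, `|f (X w)| <= C) -> P.-integrable setT (EFin \o (fun w => f (X w))).
Proof.
move=> cf fC; apply: measurable_bounded_integrable => //.
- by rewrite (le_lt_trans (probability_le1 P measurableT)) ?ltry.
- by apply: measurableT_comp => //; exact: continuous_measurable_fun.
- exists C; split; first exact: num_real.
  by move=> r Cr w _ /=; rewrite (le_trans (fC w))// ltW.
Qed.

Lemma norm_integrand_le k (th x y t : R) : 0 <= t ->
  `|t ^+ k * expR (- (y * t)) * cos (x * t + th)| <= t ^+ k * expR (- (y * t)).
Proof.
move=> t0; rewrite normrM ger0_norm ?mulr_ge0 ?exprn_ge0 ?expR_ge0//.
by rewrite ler_piMr ?mulr_ge0 ?exprn_ge0 ?expR_ge0// ler_norml cos_geN1 cos_le1.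
Qed.

Lemma continuous_integrand k th x y :
  continuous (fun t : R => t ^+ k * expR (- (y * t)) * cos (x * t + th)).
Proof.
move=> t; apply: cvgM; first apply: cvgM.
- exact: exprn_continuous.
- apply: continuous_comp; last exact: continuous_expR.
  by apply: cvgN; apply: cvgMr; exact: cvg_id.
- apply: continuous_comp; last exact: continuous_cos.
  by apply: cvgD; [apply: cvgMr; exact: cvg_id|exact: cvg_cst].
Qed.

Lemma integrable_damped k th x y : 0 < y ->
  P.-integrable setT (EFin \o (fun w =>
    X w ^+ k * expR (- (y * X w)) * cos (x * X w + th))).
Proof.
move=> y0; have [C HC] := exprn_expRN_bounded k y0.
apply: (@bounded_integrable (fun t => t ^+ k * expR (- (y * t)) * cos (x * t + th)) C).
  exact: continuous_integrand.
by move=> w; rewrite (le_trans (norm_integrand_le _ _ _ _ _)) ?HC.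
Qed.

(** For [k = 0] the integrand is bounded by 1 without any decay, so the boundary [y = 0] is
    included. *)
Lemma integrable_damped0 th x y : 0 <= y ->
  P.-integrable setT (EFin \o (fun w =>
    X w ^+ 0 * expR (- (y * X w)) * cos (x * X w + th))).
Proof.
move=> y0.
apply: (@bounded_integrable (fun t => t ^+ 0 * expR (- (y * t)) * cos (x * t + th)) 1).
  exact: continuous_integrand.
move=> w; rewrite (le_trans (norm_integrand_le _ _ _ _ _))//.
by rewrite expr0 mul1r expR_le1 oppr_le0 mulr_ge0.
Qed.

Lemma is_derive_damped_x k (th x y : R) : 0 < y ->
  is_derive x (1 : R) (fun x => phi k th x y) (phi k.+1 (th + pi / 2) x y).
Proof.
move=> y0; have [C HC] := exprn_expRN_bounded k.+1 y0.
apply: (@is_derive_Rintegral R _ _ P _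
  (fun x w => X w ^+ k.+1 * expR (- (y * X w)) * cos (x * X w + (th + pi / 2)))
  (fun=> C) (x - 1) (x + 1)).
- by apply/andP; split; lra.
- by move=> z _; exact: integrable_damped.
- move=> z w _; set t := X w.
  have D : is_derive z (1 : R) (fun z => z * t + th) t.
    apply: is_derive_eq (is_deriveD (is_deriveM (is_derive_id _ _)
      (is_derive_cst _ _ _)) (is_derive_cst _ _ _)) _.
    by rewrite /GRing.scale /cst /= mulr0 mulr1 add0r ?addr0.
  apply: is_derive_eq (is_deriveZ (t ^+ k * expR (- (y * t)))
    (is_derive1_comp (is_derive_cos _) D)) _.
  rewrite addrA cosD cos_pihalf sin_pihalf /GRing.scale/= exprS; ring.
- by apply: (@bounded_integrable (fun=> C) `|C|) => //; exact: cst_continuous.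
- by move=> z w _; rewrite (le_trans (norm_integrand_le _ _ _ _ _)) ?HC.
Qed.

Lemma is_derive_damped_y k (th x y : R) : 0 < y ->
  is_derive y (1 : R) (fun y => phi k th x y) (- phi k.+1 th x y).
Proof.
move=> y0; have y20 : 0 < y / 2 by lra.
(* The domination must hold for all nearby heights; above [y / 2] the damping is at least as strong
   as at [y / 2]. *)
have [C HC] := exprn_expRN_bounded k.+1 y20.
have -> : - phi k.+1 th x y = \int[P]_w
    (- 1 * (X w ^+ k.+1 * expR (- (y * X w)) * cos (x * X w + th))).
  by rewrite RintegralZl ?mulN1r//; exact: integrable_damped.
apply: (@is_derive_Rintegral R _ _ P _
  (fun y w => - 1 * (X w ^+ k.+1 * expR (- (y * X w)) * cos (x * X w + th)))
  (fun=> C) (y / 2) (y + 1)).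
- by apply/andP; split; lra.
- by move=> z /andP[z0 _]; apply: integrable_damped; lra.
- move=> z w _; set t := X w.
  have D : is_derive z (1 : R) (fun z => - (z * t)) (- t).
    apply: is_derive_eq (is_deriveN (is_deriveM (is_derive_id _ _)
      (is_derive_cst _ _ _))) _.
    by rewrite /GRing.scale /cst /= mulr0 mulr1 add0r ?addr0.
  apply: is_derive_eq (is_deriveM (is_deriveZ (t ^+ k)
    (is_derive1_comp (is_derive_expR _) D)) (is_derive_cst (cos (x * t + th)) _ _)) _.
  rewrite /GRing.scale/= exprS; ring.
- by apply: (@bounded_integrable (fun=> C) `|C|) => //; exact: cst_continuous.
- move=> z w /andP[z0 _]; rewrite mulN1r normrN.
  rewrite (le_trans (norm_integrand_le _ _ _ _ _))//.
  apply: le_trans (HC _ (X_ge0 w)); rewrite ler_wpM2l ?exprn_ge0//.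
  by rewrite ler_expR lerN2 ler_wpM2r// ltW.
Qed.

Lemma damped_momentDpi k th x y : 0 < y -> phi k (th + pi) x y = - phi k th x y.
Proof.
move=> y0; rewrite -mulN1r -RintegralZl//; last exact: integrable_damped.
by apply: eq_Rintegral => w _; rewrite addrA cosDpi; ring.
Qed.

(** Two [x]-derivatives shift the phase by [pi], hence the sign. With the opposite sign in
    [jet2_damped_y], every damped moment is harmonic. *)
Lemma jet2_damped_x k th x y : 0 < y ->
  jet2 (fun x => phi k th x y) x (phi k.+1 (th + pi / 2) x y)
    (- phi k.+2 th x y).
Proof.
move=> y0; exists (fun x => phi k.+1 (th + pi / 2) x y).
  by near=> t; exact: is_derive_damped_x.
split=> //; apply: is_derive_eq (is_derive_damped_x _ _ _ y0) _.
by rewrite -damped_momentDpi// -addrA -splitr.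
Unshelve. all: by end_near. Qed.

Lemma jet2_damped_y k th x y : 0 < y ->
  jet2 (phi k th x) y (- phi k.+1 th x y) (phi k.+2 th x y).
Proof.
move=> y0; exists (fun y => - phi k.+1 th x y).
  near=> t; apply: is_derive_damped_y; near: t; exact: lt_nbhsr.
split=> //; apply: is_derive_eq (is_deriveN (is_derive_damped_y _ _ _ y0)) _.
by rewrite opprK.
Unshelve. all: by end_near. Qed.

(** Cosine and, on nonnegative reals, [expR (- t)] are 1-Lipschitz, so the integrand varies by at
    most [X w] times the displacement. This gives continuity up to [y = 0]. *)
Lemma damped_moment_Lipschitz th x y x' y' :
  P.-integrable setT (EFin \o X) -> 0 <= y -> 0 <= y' ->
  `|phi 0 th x y - phi 0 th x' y'| <= (`|x - x'| + `|y - y'|) * \int[P]_w X w.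
Proof.
move=> iX y0 y'0; rewrite -RintegralB//; [|exact: integrable_damped0..].
rewrite -RintegralZl//.
have iB : P.-integrable setT (EFin \o (fun w =>
    X w ^+ 0 * expR (- (y * X w)) * cos (x * X w + th) -
    X w ^+ 0 * expR (- (y' * X w)) * cos (x' * X w + th))).
  have := integrableB measurableT (integrable_damped0 th x y0)
    (integrable_damped0 th x' y'0).
  by apply: eq_integrable.
apply: le_trans (le_normr_Rintegral measurableT iB) _.
apply: le_Rintegral => //.
- by have := integrable_norm iB.
- by have := integrableZl measurableT (`|x - x'| + `|y - y'|) iX.
move=> w _; rewrite !expr0 !mul1r; have t0 := X_ge0 w; set t := X w in t0 *.
set e := expR _; set e' := expR (- (y' * t)).
have -> : e * cos (x * t + th) - e' * cos (x' * t + th) =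
  e * (cos (x * t + th) - cos (x' * t + th)) + (e - e') * cos (x' * t + th).
  by ring.
have e1 : e <= 1 by rewrite expR_le1 oppr_le0 mulr_ge0.
apply: le_trans (ler_normD _ _) _.
rewrite [leRHS]mulrDl !normrM lerD//.
  rewrite (@ger0_norm _ e) ?expR_ge0//.
  rewrite (le_trans (ler_piMl _ e1))// (le_trans (dist_cos_le _ _))//.
  by rewrite opprD addrACA subrr addr0 -mulrBl normrM (@ger0_norm _ t).
rewrite (le_trans (ler_piMr _ (_ : `|cos (x' * t + th)| <= 1)))//.
  by rewrite ler_norml cos_geN1 cos_le1.
rewrite (le_trans (dist_expRN_le _ _)) ?mulr_ge0//.
by rewrite -mulrBl normrM (@ger0_norm _ t).
Qed.

End damped_moments.

(** * Harmonicity and bounds of the arctangent *)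

Section arctangent.
Context {R : realType}.
Implicit Types (a p s t x y : R).

(** The second derivatives here and in [jet2_atan_div_inv] are opposite: the angle [atan (p / s)] is
    harmonic in [(p, s)]. *)
Lemma jet2_atan_div p s : 0 < s ->
  jet2 (fun p => atan (p / s)) p (s / (s ^+ 2 + p ^+ 2))
    (- (2 * s * p) / (s ^+ 2 + p ^+ 2) ^+ 2).
Proof.
move=> s0; have s_neq0 : s != 0 by rewrite gt_eqF.
have q0 : s ^+ 2 + p ^+ 2 != 0 by rewrite gt_eqF// ltr_pwDl ?exprn_gt0 ?sqr_ge0.
have := jet2_comp (jet2M (jet2_id p) (jet2_cst s^-1 p)) (jet2_atan (p / s)).
have q1 : 1 + (p / s) ^+ 2 = (s ^+ 2 + p ^+ 2) / s ^+ 2 by field.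
by move=> /jet2_eq; apply; rewrite q1 /=; field; rewrite s_neq0 q0.
Qed.

Lemma jet2_atan_div_inv p s : 0 < s ->
  jet2 (fun s => atan (p / s)) s (- p / (s ^+ 2 + p ^+ 2))
    (2 * s * p / (s ^+ 2 + p ^+ 2) ^+ 2).
Proof.
move=> s0; have s_neq0 : s != 0 by rewrite gt_eqF.
have q0 : s ^+ 2 + p ^+ 2 != 0 by rewrite gt_eqF// ltr_pwDl ?exprn_gt0 ?sqr_ge0.
have := jet2_comp (jet2_scale p (jet2_inv s_neq0)) (jet2_atan (p / s)).
have q1 : 1 + (p / s) ^+ 2 = (s ^+ 2 + p ^+ 2) / s ^+ 2 by field.
by move=> /jet2_eq; apply; rewrite q1 /=; field; rewrite s_neq0 q0.
Qed.

Lemma atan_inv t : 0 < t -> atan t^-1 = pi / 2 - atan t.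
Proof.
move=> t0; have at0 : 0 < atan t by rewrite -(@atan0 R) lt_atan.
have atpi := atan_ltpi2 t.
apply: tan_inj.
- by rewrite in_itv/= atan_gtNpi2 atan_ltpi2.
- by rewrite in_itv/=; apply/andP; split; have := pi_gt0 R; lra.
rewrite atanK /tan.
have -> : sin (pi / 2 - atan t) = cos (atan t).
  by rewrite sinB sin_pihalf cos_pihalf mul1r mul0r subr0.
have -> : cos (pi / 2 - atan t) = sin (atan t).
  by rewrite cosB sin_pihalf cos_pihalf mul1r mul0r add0r.
by rewrite -{1}[t]atanK /tan invf_div.
Qed.

Lemma atan_MVT t : 0 < t -> exists2 c, 0 < c < t & atan t = t / (1 + c ^+ 2).
Proof.
move=> t0.
have cc : {within `[0, t], continuous (@atan R)}.
  by apply: continuous_subspaceT; exact: continuous_atan.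
have [c] := MVT t0 (fun x _ => is_derive1_atan x) cc.
rewrite in_itv/= atan0 !subr0 => ct E; exists c => //.
by rewrite E mulrC.
Qed.

Lemma atan_le t : 0 < t -> atan t <= t.
Proof.
move=> t0; have [c _ ->] := atan_MVT t0.
by rewrite ler_pdivrMr ?ltr_pwDl ?sqr_ge0// ler_peMr ?lerDl ?sqr_ge0// ltW.
Qed.

Lemma atan_ge t : 0 < t -> t / (1 + t ^+ 2) <= atan t.
Proof.
move=> t0; have [c /andP[c0 ct] ->] := atan_MVT t0.
rewrite ler_wpM2l ?(ltW t0)// lef_pV2 ?posrE ?ltr_pwDl ?sqr_ge0//.
by rewrite lerD2l; apply: lerXn2r; rewrite ?nnegrE ltW// (lt_trans c0).
Qed.

End arctangent.

(** Plays the part of a limit [e -> 0]; the penalty, the shift [de], the enlargement of [D] and the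
    height [y] are all removed this way. *)
Lemma le_of_le_small {R : realFieldType} (A B C e0 : R) : 0 < e0 ->
  (forall e, 0 < e < e0 -> A <= B + e * C) -> A <= B.
Proof.
move=> e00 H; rewrite leNgt; apply/negP => BA.
have C0 : 0 < 2 * (`|C| + 1) by have := normr_ge0 C; lra.
pose e := Num.min (e0 / 2) ((A - B) / (2 * (`|C| + 1))).
have e_gt0 : 0 < e by rewrite lt_min !divr_gt0// subr_gt0.
have ee0 : e <= e0 / 2 by rewrite ge_min lexx.
have eAB : e * (2 * (`|C| + 1)) <= A - B.
  by rewrite -ler_pdivlMr// ge_min lexx orbT.
have : A <= B + e * C by apply: H; rewrite e_gt0/=; lra.
have : e * C <= e * `|C| by rewrite ler_pM2l// ler_norm.
by nra.
Qed.

(** * Laplacians of the weighted modulus, the barrier and the harmonic measure *)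

Section weighted_modulus.
Context {R : realType}.
Implicit Types (x y lam : R).

Lemma jet2_weighted_modulus (u v h : R -> R) c lam u1 u2 v1 v2 h1 h2 :
  jet2 u c u1 u2 -> jet2 v c v1 v2 -> jet2 h c h1 h2 ->
  exists f1, jet2 (fun t => (u t ^+ 2 + v t ^+ 2) * expR (2 * lam * h t)) c f1
   (expR (2 * lam * h c) *
    (2 * (u1 ^+ 2 + u c * u2 + v1 ^+ 2 + v c * v2) +
     8 * lam * (u c * u1 + v c * v1) * h1 +
     (u c ^+ 2 + v c ^+ 2) * (4 * lam ^+ 2 * h1 ^+ 2 + 2 * lam * h2))).
Proof.
move=> U V H; have := jet2M (jet2D (jet2M U U) (jet2M V V))
  (jet2_comp (jet2_scale (2 * lam) H) (jet2_expR _)).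
move=> J; eexists; apply: jet2_eq J _ _; first reflexivity.
by cbv beta; ring.
Qed.

(* By the Cauchy-Riemann equations [uy = - vx], [vy = ux], the Laplacian of
   [(u^2 + v^2) exp (2 lam h)] is [4 exp (2 lam h)] times this sum of squares. *)
Lemma weighted_modulus_laplacian (u v ux vx uxx vxx hx hy hxx lam : R) :
  (2 * (ux ^+ 2 + u * uxx + vx ^+ 2 + v * vxx) +
   8 * lam * (u * ux + v * vx) * hx +
   (u ^+ 2 + v ^+ 2) * (4 * lam ^+ 2 * hx ^+ 2 + 2 * lam * hxx)) +
  (2 * ((- vx) ^+ 2 + u * - uxx + ux ^+ 2 + v * - vxx) +
   8 * lam * (u * - vx + v * ux) * hy +
   (u ^+ 2 + v ^+ 2) * (4 * lam ^+ 2 * hy ^+ 2 + 2 * lam * - hxx)) =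
  4 * ((ux + lam * (u * hx + v * hy)) ^+ 2 +
       (vx + lam * (v * hx - u * hy)) ^+ 2).
Proof. by ring. Qed.

(** The first term is twice the logarithm of the distance to [(0, -1)], harmonic and growing at
    infinity; the strictly concave [ln (y + 1)] makes the sum strictly superharmonic. The shift by 1
    keeps both terms smooth and nonnegative for [0 <= y]. *)
Definition log_barrier x y : R := ln (x ^+ 2 + (y + 1) ^+ 2) + ln (y + 1).

Lemma log_barrier_ge0 x y : 0 <= y -> 0 <= log_barrier x y.
Proof.
move=> y0; have y1 : 1 <= y + 1 by lra.
by rewrite addr_ge0// ln_ge0// ler_wpDl ?sqr_ge0// exprn_ege1.
Qed.

Lemma log_barrier_large x y K : 0 <= K -> 0 <= y ->
  expR K <= `|x| \/ expR K <= y -> K <= log_barrier x y.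
Proof.
move=> K0 y0 xy; have y1 : 1 <= y + 1 by lra.
have k1 : 1 <= expR K by rewrite -expR0 ler_expR.
rewrite /log_barrier ler_wpDr ?ln_ge0// -[leLHS]expRK ler_ln ?posrE ?expR_gt0//.
  case: xy => [kx|ky]; last by have := sqr_ge0 x; nra.
  by rewrite -(real_normK (num_real x)); nra.
by rewrite ltr_wpDl ?sqr_ge0// exprn_gt0//; lra.
Qed.

Lemma jet2_log_barrier_x x y : 0 <= y -> exists f1,
  jet2 (log_barrier ^~ y) x f1 (2 / (x ^+ 2 + (y + 1) ^+ 2)
    - 4 * x ^+ 2 / (x ^+ 2 + (y + 1) ^+ 2) ^+ 2).
Proof.
move=> y0; have q0 : 0 < x * x + (y + 1) ^+ 2.
  by rewrite -expr2 ltr_wpDl ?sqr_ge0// exprn_gt0//; lra.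
have J := jet2D (jet2_comp (jet2D (jet2M (jet2_id x) (jet2_id x))
  (jet2_cst ((y + 1) ^+ 2) x)) (jet2_ln q0)) (jet2_cst (ln (y + 1)) x).
eexists; apply: jet2_eq J _ _; first reflexivity.
by cbv beta; rewrite /=; field; rewrite gt_eqF.
Qed.

Lemma jet2_log_barrier_y x y : 0 <= y -> exists f1,
  jet2 (log_barrier x) y f1 (2 / (x ^+ 2 + (y + 1) ^+ 2)
    - 4 * (y + 1) ^+ 2 / (x ^+ 2 + (y + 1) ^+ 2) ^+ 2 - (y + 1) ^- 2).
Proof.
move=> y0; have s0 : 0 < y + 1 by lra.
have q0 : 0 < x ^+ 2 + (y + 1) * (y + 1).
  by rewrite -expr2 ltr_wpDl ?sqr_ge0// exprn_gt0.
have S := jet2D (jet2_id y) (jet2_cst 1 y).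
have J := jet2D (jet2_comp (jet2D (jet2_cst (x ^+ 2) y) (jet2M S S))
  (jet2_ln q0)) (jet2_comp S (jet2_ln s0)).
eexists; apply: jet2_eq J _ _; first reflexivity.
by cbv beta; rewrite /=; field; rewrite !gt_eqF.
Qed.

Lemma log_barrier_laplacian x y : 0 <= y ->
  (2 / (x ^+ 2 + (y + 1) ^+ 2) - 4 * x ^+ 2 / (x ^+ 2 + (y + 1) ^+ 2) ^+ 2) +
  (2 / (x ^+ 2 + (y + 1) ^+ 2)
    - 4 * (y + 1) ^+ 2 / (x ^+ 2 + (y + 1) ^+ 2) ^+ 2 - (y + 1) ^- 2) < 0.
Proof.
move=> y0; have s0 : 0 < y + 1 by lra.
have q0 : 0 < x ^+ 2 + (y + 1) ^+ 2 by rewrite ltr_wpDl ?sqr_ge0// exprn_gt0.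
rewrite [ltLHS](_ : _ = - (y + 1) ^- 2) ?oppr_lt0 ?invr_gt0 ?exprn_gt0//.
by field; rewrite !gt_eqF.
Qed.

Variables (a de : R).
Hypothesis a_gt0 : 0 < a.
Hypothesis de_gt0 : 0 < de.

(* Harmonic measure of [{t | a <= `|t|}] in the upper half plane, seen from the
   shifted point [(x, y + de)] so that it extends smoothly to [y = 0]. *)
Definition outer_harmonic_measure x y : R :=
  1 - pi^-1 * (atan ((a - x) / (y + de)) + atan ((a + x) / (y + de))).

Local Notation h := outer_harmonic_measure.

(** Harmonicity is recorded by reusing [hxx] with opposite sign. The values stay existential because
    [weighted_modulus_laplacian] holds for any gradient of [h]. *)
Lemma jet2_height x y : 0 <= y -> exists hx hxx hy,
  jet2 (h ^~ y) x hx hxx /\ jet2 (h x) y hy (- hxx).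
Proof.
move=> y0; have s0 : 0 < y + de by rewrite ltr_wpDl.
have Jm := jet2_comp (jet2B (jet2_cst a x) (jet2_id x)) (jet2_atan_div (a - x) s0).
have Jp := jet2_comp (jet2D (jet2_cst a x) (jet2_id x)) (jet2_atan_div (a + x) s0).
have S := jet2D (jet2_id y) (jet2_cst de y).
have Km := jet2_comp S (jet2_atan_div_inv (a - x) s0).
have Kp := jet2_comp S (jet2_atan_div_inv (a + x) s0).
have Jx := jet2B (jet2_cst 1 x) (jet2_scale pi^-1 (jet2D Jm Jp)).
have Jy := jet2B (jet2_cst 1 y) (jet2_scale pi^-1 (jet2D Km Kp)).
do 3 eexists; split; first exact: Jx.
by apply: jet2_eq Jy _ _; [reflexivity|ring].
Qed.

(** Since [a > 0], [- (a + x) <= a - x]; as arctangent is odd and increasing, the two angles have a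
    nonnegative sum. *)
Lemma height_le1 x y : 0 <= y -> h x y <= 1.
Proof.
move=> y0; have s0 : 0 < y + de by rewrite ltr_wpDl.
rewrite lerBlDr lerDl mulr_ge0 ?invr_ge0 ?pi_ge0//.
rewrite -lerBlDr sub0r -atanN; apply: le_atan.
by rewrite -mulNr ler_pM2r ?invr_gt0//; move: a_gt0; lra.
Qed.

(** Both [a - x] and [a + x] are at least [a - D], so each angle is at least the one at the
    endpoint. *)
Lemma height_boundary_le x D : `|x| <= D ->
  h x 0 <= 1 - pi^-1 * (2 * atan ((a - D) / de)).
Proof.
rewrite ler_norml => /andP[x1 x2]; rewrite /h add0r lerD2l lerN2.
rewrite ler_pM2l ?invr_gt0 ?pi_gt0// mulr_natl mulr2n.
by apply: lerD; apply: le_atan; rewrite ler_pM2r ?invr_gt0//; lra.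
Qed.

End weighted_modulus.

(** * Comparison of [|Phi|] with the harmonic measure *)

Section half_plane_bound.
Context (d : measure_display) (T : measurableType d) (R : realType)
  (P : probability T R) (X : {RV P >-> R}).
Hypothesis X_ge0 : forall w, 0 <= X w.
Hypothesis intX : P.-integrable setT (EFin \o X).

Local Notation u := (damped_moment X 0 0).
Local Notation v := (damped_moment X 0 (- (pi / 2))).

Lemma charfun_abs_sqr x : charfun_abs P X x ^+ 2 = u x 0 ^+ 2 + v x 0 ^+ 2.
Proof.
rewrite sqr_sqrtr ?addr_ge0 ?sqr_ge0//; congr (_ ^+ 2 + _ ^+ 2);
  apply: eq_Rintegral => w _; rewrite mul0r oppr0 expR0 expr0 !mul1r.
  by rewrite addr0.
by rewrite cosBpihalf.
Qed.

(* Projecting the integrand on the direction [(u, v)] gives [u^2 + v^2 <= r]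
   for [r = sqrt (u^2 + v^2)]. *)
Lemma damped_modulus_le1 x y : 0 <= y -> u x y ^+ 2 + v x y ^+ 2 <= 1.
Proof.
move=> y0; set U := u x y; set V := v x y.
pose r := Num.sqrt (U ^+ 2 + V ^+ 2).
have r0 : 0 <= r by exact: sqrtr_ge0.
have rE : r ^+ 2 = U ^+ 2 + V ^+ 2 by rewrite sqr_sqrtr ?addr_ge0 ?sqr_ge0.
have iU := integrable_damped0 X_ge0 0 x y0.
have iV := integrable_damped0 X_ge0 (- (pi / 2)) x y0.
have iUU := integrableZl measurableT U iU.
have iVV := integrableZl measurableT V iV.
suff : r ^+ 2 <= r by rewrite -rE; nra.
rewrite {1}rE !expr2 {2}/U {2}/V /damped_moment -!RintegralZl// -RintegralD//.
rewrite -[leRHS]mulr1.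
have -> : r * 1 = \int[P]_w r.
  have P1 : fine (P setT) = 1 by rewrite probability_setT.
  by rewrite Rintegral_cst//; congr (_ * _); rewrite -P1.
apply: le_Rintegral => //.
- by have := integrableD measurableT iUU iVV.
- by apply: (@bounded_integrable _ _ _ _ X (fun=> r) `|r|) => //; exact: cst_continuous.
move=> w _ /=; rewrite expr0 !mul1r addr0 cosBpihalf.
set e := expR _; set c := cos _; set s := sin _.
have e0 : 0 <= e by exact: expR_ge0.
have e1 : e <= 1 by rewrite expR_le1 oppr_le0 mulr_ge0.
have cs : c ^+ 2 + s ^+ 2 = 1 by exact: cos2Dsin2.
(* Cauchy-Schwarz, from Lagrange's identity with the square of [U * s - V * c]. *)
have Ucs : U * c + V * s <= r.
  rewrite (le_trans (ler_norm _))// -sqrtr_sqr ler_wsqrtr//.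
  have := sqr_ge0 (U * s - V * c); move: cs; clear; move=> cs.
  have -> : U ^+ 2 + V ^+ 2 = (U ^+ 2 + V ^+ 2) * (c ^+ 2 + s ^+ 2).
    by rewrite cs mulr1.
  by nra.
have -> : U * (e * c) + V * (e * s) = e * (U * c + V * s) by ring.
by rewrite (le_trans (ler_wpM2l e0 Ucs))// ler_piMl.
Qed.

Lemma continuous_damped th :
  continuous (fun p : R * R => damped_moment X 0 th p.1 `|p.2|).
Proof.
move=> p; apply/cvgrPdist_le => e e0.
pose tau := \int[P]_w X w.
pose dist (q : R * R) := (`|p.1 - q.1| + `| `|p.2| - `|q.2| |) * tau.
have dist0 : dist q @[q --> p] --> 0.
  have -> : 0 = (`|p.1 - p.1| + `| `|p.2| - `|p.2| |) * tau.
    by rewrite !subrr !normr0 addr0 mul0r.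
  apply: cvgM; last exact: cvg_cst.
  apply: cvgD; apply: cvg_norm; (apply: cvgB; first exact: cvg_cst).
    exact: cvg_fst.
  by apply: cvg_norm; exact: cvg_snd.
near=> q; apply: (@le_trans _ _ (dist q)).
  exact: damped_moment_Lipschitz.
by near: q; exact: cvgr_le dist0 _ e0.
Unshelve. all: by end_near. Qed.

Variables (lam a de D : R).
Hypothesis lam_ge0 : 0 <= lam.
Hypothesis de_gt0 : 0 < de.
Hypothesis D_gt0 : 0 < D.
Hypothesis aD : D < a.
Hypothesis decay : forall x, D <= `|x| -> charfun_abs P X x <= expR (- lam).

Local Notation h := (outer_harmonic_measure a de).
(** Smoothing error: a bound for [h] on the boundary segment where no decay is assumed. It tends to
    0 with [de]. *)
Let kappa := 1 - pi^-1 * (2 * atan ((a - D) / de)).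
Let a_gt0 : 0 < a := lt_trans D_gt0 aD.

Definition weighted_modulus x y :=
  (u x y ^+ 2 + v x y ^+ 2) * expR (2 * lam * h x y).

Lemma kappa_ge0 : 0 <= kappa.
Proof.
rewrite subr_ge0 ler_pdivrMl ?pi_gt0// mulr1.
by have := atan_ltpi2 ((a - D) / de); lra.
Qed.

Lemma weighted_modulus_le x y : 0 <= y -> weighted_modulus x y <= expR (2 * lam).
Proof.
move=> y0; rewrite /weighted_modulus.
apply: (le_trans (ler_piMl (expR_ge0 _) (damped_modulus_le1 _ y0))).
rewrite ler_expR ler_piMr ?mulr_ge0//; exact: height_le1.
Qed.

(** On [|x| <= D] the modulus is at most 1 and [h <= kappa]; outside, the decay [expR (- lam) ^+ 2]
    cancels the weight because [h <= 1]. *)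
Lemma weighted_modulus_boundary x : weighted_modulus x 0 <= expR (2 * lam * kappa).
Proof.
have k0 := kappa_ge0; have l0 : 0 <= 2 * lam by rewrite mulr_ge0.
have [xD|Dx] := leP `|x| D.
  apply: (le_trans (ler_piMl (expR_ge0 _) (damped_modulus_le1 _ (lexx 0)))).
  by rewrite ler_expR ler_wpM2l//; exact: height_boundary_le.
apply: (@le_trans _ _ 1); last by rewrite -[leLHS]expR0 ler_expR mulr_ge0.
rewrite /weighted_modulus -charfun_abs_sqr.
have E : expR (- lam) ^+ 2 * expR (2 * lam) = 1.
  by rewrite expr2 -!expRD -[RHS]expR0; congr expR; ring.
rewrite -[leRHS]E.
apply: ler_pM; rewrite ?sqr_ge0 ?expR_ge0//.
  by apply: lerXn2r; rewrite ?nnegrE ?expR_ge0 ?sqrtr_ge0 ?decay// ltW.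
by rewrite ler_expR ler_piMr//; exact: height_le1.
Qed.

Lemma continuous_penalized eps :
  continuous (fun p : R * R => weighted_modulus p.1 `|p.2| -
    eps * log_barrier p.1 `|p.2|).
Proof.
move=> p.
have c1 : q.1 @[q --> p] --> p.1 by exact: cvg_fst.
have c2 : `|q.2| @[q --> p] --> `|p.2| by apply: cvg_norm; exact: cvg_snd.
have s0 : 0 < `|p.2| + de by rewrite ltr_wpDl.
have s1 : 0 < `|p.2| + 1 by rewrite ltr_wpDl.
have cs : (`|q.2| + de)^-1 @[q --> p] --> (`|p.2| + de)^-1.
  by apply: cvgV; [rewrite gt_eqF|apply: cvgD => //; exact: cvg_cst].
have cs1 : `|q.2| + 1 @[q --> p] --> `|p.2| + 1.
  by apply: cvgD => //; exact: cvg_cst.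
have cX (f : R * R -> R) : f q @[q --> p] --> f p ->
  f q ^+ 2 @[q --> p] --> f p ^+ 2 by move=> cf; apply: cvgM.
have ch : h q.1 `|q.2| @[q --> p] --> h p.1 `|p.2|.
  apply: cvgB; first exact: cvg_cst.
  apply: cvgM; first exact: cvg_cst.
  apply: cvgD; (apply: cvg_comp; last exact: continuous_atan).
    by apply: cvgM => //; apply: cvgB => //; exact: cvg_cst.
  by apply: cvgM => //; apply: cvgD => //; exact: cvg_cst.
apply: cvgB.
  apply: cvgM.
    by apply: cvgD; apply: cX; exact: continuous_damped.
  apply: (cvg_comp (fun q : R * R => 2 * lam * h q.1 `|q.2|) expR);
    last exact: continuous_expR.
  by apply: cvgM => //; exact: cvg_cst.
apply: cvgM; first exact: cvg_cst.
apply: cvgD.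
  apply: cvg_comp; last first.
    by apply: continuous_ln; rewrite ltr_wpDl ?sqr_ge0// exprn_gt0.
  by apply: cvgD; apply: cX.
by apply: cvg_comp; last exact: continuous_ln.
Qed.

(** The weighted modulus is subharmonic, and subtracting a positive multiple of the strictly
    superharmonic barrier makes the Laplacian strictly positive. *)
Lemma penalized_subharmonic eps x y : 0 < eps -> 0 < y ->
  let W x y := weighted_modulus x y - eps * log_barrier x y in
  exists fx fxx fy fyy,
    [/\ jet2 (W ^~ y) x fx fxx, jet2 (W x) y fy fyy & 0 < fxx + fyy].
Proof.
move=> e0 y0 W.
have [hx [hxx [hy [Hx Hy]]]] := jet2_height a de_gt0 x (ltW y0).
have [px Px] := jet2_log_barrier_x x (ltW y0).
have [py Py] := jet2_log_barrier_y x (ltW y0).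
have [mx Mx] := jet2_weighted_modulus lam (jet2_damped_x X_ge0 0 0 x y0)
  (jet2_damped_x X_ge0 0 (- (pi / 2)) x y0) Hx.
have [my My] := jet2_weighted_modulus lam (jet2_damped_y X_ge0 0 0 x y0)
  (jet2_damped_y X_ge0 0 (- (pi / 2)) x y0) Hy.
have Jx := jet2B Mx (jet2_scale eps Px).
have Jy := jet2B My (jet2_scale eps Py).
do 4 eexists; split; [exact: Jx|exact: Jy|].
(* The phases [pi / 2] and [- (pi / 2)] differ by [pi]; this is the Cauchy-Riemann equation
   [ux = vy]. *)
have CR : damped_moment X 1 (0 + pi / 2) x y = - damped_moment X 1 (- (pi / 2)) x y.
  rewrite -(damped_momentDpi X_ge0)//; congr damped_moment.
  by field.
rewrite CR addNr.
set A := (X in X - _ + _); set B := (X in _ + (X - _)).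
set p := (X in A - eps * X); set q := (X in B - eps * X).
have pq : p + q < 0 by exact: log_barrier_laplacian (ltW y0).
suff AB : 0 <= A + B.
  have -> : A - eps * p + (B - eps * q) = (A + B) + eps * (- (p + q)) by ring.
  by rewrite ltr_wpDl// mulr_gt0// oppr_gt0.
rewrite /A /B -mulrDr mulr_ge0 ?expR_ge0//.
set m1 := damped_moment X 1 _ x y; set n1 := damped_moment X 1 _ x y.
set m2 := damped_moment X 2 _ x y; set n2 := damped_moment X 2 _ x y.
have := weighted_modulus_laplacian (u x y) (v x y) (- m1) n1 (- m2) (- n2)
  hx hy hxx lam.
rewrite !opprK => ->.
by rewrite mulr_ge0 ?addr_ge0 ?sqr_ge0.
Qed.

Lemma weighted_modulus_bound x y : 0 <= y ->
  weighted_modulus x y <= expR (2 * lam * kappa).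
Proof.
move=> y0.
apply: (@le_of_le_small _ _ _ (log_barrier x y) 1) => // e /andP[e0 _].
rewrite -lerBlDr.
(* Beyond this radius the barrier is at least [expR (2 * lam) / e], so the penalty outweighs the
   crude bound [weighted_modulus_le] and the difference is nonpositive. *)
apply: (@half_plane_max_principle R
  (fun x y => weighted_modulus x y - e * log_barrier x y)
  _ (expR (expR (2 * lam) / e))) => //.
- exact: continuous_penalized.
- move=> z; rewrite lerBlDr ler_wpDr ?weighted_modulus_boundary//.
  by rewrite mulr_ge0 ?(ltW e0)// log_barrier_ge0.
- move=> z t t0 zt; apply: le_trans (expR_ge0 _); rewrite subr_le0.
  rewrite (le_trans (weighted_modulus_le _ t0))// -ler_pdivrMl// mulrC.
  by apply: log_barrier_large => //; rewrite divr_ge0 ?expR_ge0 ?ltW.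
- by move=> z t t0; exact: penalized_subharmonic.
Qed.

(** On the imaginary axis the cosine is 1, and [1 - s <= expR (- s)] is integrated. *)
Lemma damped_moment_axis_ge y : 0 <= y -> 1 - y * \int[P]_w X w <= u 0 y.
Proof.
move=> y0.
have i1 : P.-integrable setT (EFin \o (fun=> 1 : R)).
  by apply: (@bounded_integrable _ _ _ _ X (fun=> 1) `|1|) => //; exact: cst_continuous.
have iy := integrableZl measurableT y intX.
have P1 : fine (P setT) = 1 by rewrite probability_setT.
have -> : 1 - y * \int[P]_w X w = \int[P]_w (1 - y * X w).
  rewrite RintegralB// RintegralZl// Rintegral_cst//; congr (_ - _).
  by rewrite mul1r -P1.
apply: le_Rintegral => //.
- by have := integrableB measurableT i1 iy.
- exact: integrable_damped0.
move=> w _ /=; rewrite expr0 mul1r mul0r add0r cos0 mulr1.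
exact: expR_ge1Dx.
Qed.

(** By symmetry the two angles coincide on the axis; passing to the complementary angle shows linear
    growth in [y + de]. *)
Lemma height_axis y : 0 <= y -> h 0 y = 2 * pi^-1 * atan ((y + de) / a).
Proof.
move=> y0; have s0 : 0 < y + de by rewrite ltr_wpDl.
rewrite /outer_harmonic_measure subr0 addr0 -[a / _]invf_div atan_inv ?divr_gt0//.
have : pi != 0 :> R by rewrite gt_eqF ?pi_gt0.
by move: (@pi R) => q q0; field.
Qed.

Lemma kappaE : kappa = 2 * pi^-1 * atan (de / (a - D)).
Proof.
rewrite /kappa -[(a - D) / de]invf_div atan_inv ?divr_gt0 ?subr_gt0//.
have : pi != 0 :> R by rewrite gt_eqF ?pi_gt0.
by move: (@pi R) => q q0; field.
Qed.

Lemma axis_bound y : 0 < y -> y * \int[P]_w X w < 1 ->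
  (1 - y * \int[P]_w X w) *
  (1 + 2 * lam / pi * (y / a / (1 + (y / a) ^+ 2) - de / (a - D))) <= 1.
Proof.
move=> y0; set tau := \int[P]_w X w => yt.
have := weighted_modulus_bound 0 (ltW y0).
rewrite /weighted_modulus height_axis ?(ltW y0)// kappaE.
set A := atan _; set B := atan _ => H.
have mu0 : 0 <= 2 * lam / pi by rewrite divr_ge0 ?mulr_ge0 ?pi_ge0.
have HA : y / a / (1 + (y / a) ^+ 2) <= A.
  rewrite (le_trans (atan_ge _)) ?divr_gt0//; apply: le_atan.
  by rewrite ler_pM2r ?invr_gt0// lerDl ltW.
have HB : B <= de / (a - D) by rewrite atan_le// divr_gt0// subr_gt0.
(* This is [lam * (h 0 y - kappa)], half the exponent gained in the comparison, which bounds the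
   squared modulus. *)
pose w := 2 * lam / pi * (A - B).
have u0 := damped_moment_axis_ge (ltW y0); rewrite -/tau in u0.
apply: (@le_trans _ _ ((1 - y * tau) * expR w)).
  rewrite ler_wpM2l ?subr_ge0 ?(ltW yt)//.
  apply: le_trans (expR_ge1Dx _); rewrite lerD2l ler_wpM2l//.
  by rewrite lerB.
have sq : ((1 - y * tau) * expR w) ^+ 2 <= 1.
  rewrite exprMn.
  have -> : expR w ^+ 2 =
      expR (2 * lam * (2 / pi * A)) / expR (2 * lam * (2 / pi * B)).
    by rewrite expr2 -expRD -expRN -expRD; congr expR; rewrite /w; ring.
  rewrite mulrA ler_pdivrMr ?expR_gt0// mul1r; apply: le_trans H.
  rewrite ler_wpM2r ?expR_ge0//.
  apply: (@le_trans _ _ (u 0 y ^+ 2)); last by rewrite lerDl sqr_ge0.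
  have yt0 : 0 <= 1 - y * tau by rewrite subr_ge0 ltW.
  by apply: lerXn2r; rewrite ?nnegrE// (le_trans yt0).
rewrite -(@ler_sqr _ _ 1) ?nnegrE// ?expr1n//.
by rewrite mulr_ge0 ?expR_ge0// subr_ge0 ltW.
Qed.

End half_plane_bound.

(** * Passage to the limit and the final bound *)

(** Three limits are taken in [axis_bound]: first [de -> 0], which removes the smoothing error, then
    [y -> 0], and last [a -> D]. *)
Lemma decay_rate_le (d : measure_display) (T : measurableType d) (R : realType)
    (P : probability T R) (X : {RV P >-> R}) (lam D : R) :
  (forall w, 0 <= X w) -> P.-integrable setT (EFin \o X) ->
  0 <= lam -> 0 < D ->
  (forall x, D <= `|x| -> charfun_abs P X x <= expR (- lam)) ->
  lam <= D * (\int[P]_w X w) * (pi / 2).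
Proof.
move=> X0 iX lam0 D0 decay; set tau := \int[P]_w X w.
have tau0 : 0 <= tau by apply: Rintegral_ge0.
pose mu := 2 * lam / pi.
have mu0 : 0 <= mu by rewrite divr_ge0 ?mulr_ge0 ?pi_ge0.
have pi0 := pi_gt0 R.
suff : mu <= D * tau by rewrite ler_pdivrMr// => H; lra.
apply: (@le_of_le_small _ _ _ tau 1) => // e /andP[e0 _].
rewrite -mulrDl; set a := D + e; have aD : D < a by rewrite ltrDl.
have a0 : 0 < a by exact: lt_trans aD.
have t1 : 0 < tau + 1 by lra.
(* The error collects [y * tau * mu] from the factor [1 - y * tau] and [y * (tau / a)] from the
   quadratic term of the arctangent bound. Heights below [(tau + 1)^-1] satisfy both [y < 1] and
   [y * tau < 1]. *)
apply: (@le_of_le_small _ _ _ (mu * tau + tau / a) (tau + 1)^-1).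
  by rewrite invr_gt0.
move=> y /andP[y0 yt].
have yt1 : y * (tau + 1) < 1 by rewrite -ltr_pdivlMr// div1r.
have y1 : y < 1 by nra.
have {yt yt1}yt : y * tau < 1 by nra.
have t0 : 0 < y / a by rewrite divr_gt0.
set t := y / a in t0.
have : (1 - y * tau) * (1 + mu * (t / (1 + t ^+ 2))) <= 1.
  apply: (@le_of_le_small _ _ _ ((1 - y * tau) * mu / (a - D)) 1) => // de /andP[de0 _].
  have := axis_bound X0 iX lam0 de0 D0 aD decay y0 yt; rewrite -/tau -/mu -/t.
  move=> H; rewrite -lerBlDr; apply: le_trans H; rewrite le_eqVlt.
  by apply/orP; left; apply/eqP; ring.
have q0 : 0 < 1 + t ^+ 2 by rewrite ltr_pwDl ?sqr_ge0.
have -> : (1 - y * tau) * (1 + mu * (t / (1 + t ^+ 2))) =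
   (1 - y * tau) + (1 - y * tau) * mu * t / (1 + t ^+ 2) by ring.
rewrite -lerBrDl subKr ler_pdivrMr// => H.
have ya : y = t * a by rewrite /t divfK ?gt_eqF.
have {}H : (1 - y * tau) * mu <= a * tau * (1 + t ^+ 2).
  rewrite -(ler_pM2r t0) (le_trans H)// {1}ya.
  by rewrite le_eqVlt; apply/orP; left; apply/eqP; ring.
have tt : a * tau * t ^+ 2 <= y * (tau / a).
  have -> : a * tau * t ^+ 2 = y * (y * (tau / a)).
    by rewrite /t; field; rewrite gt_eqF.
  rewrite ler_wpM2l ?(ltW y0)// ler_piMl ?(ltW y1)//.
  by rewrite divr_ge0 // ltW.
by lra.
Qed.

Unset Implicit Arguments.
Set Strict Implicit.

Theorem theorem3 (d : measure_display) (T : measurableType d) (R : realType)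
  (P : probability T R) (X : {RV P >-> R})
  (Xpos : forall x, 0 < X x) (Delta : R) (hDelta : 0 < Delta) :
  (expeR (- (Delta%:E * 'E_P[X] * (pi / 2)%:E))
   <= ereal_sup [set (charfun_abs P X w)%:E | w in [set w : R | (Delta <= `|w|)%R]])%E.
Proof.
set S := ereal_sup _.
have X0 w : 0 <= X w by exact: ltW.
have pi2 : 0 < pi / 2 :> R by rewrite divr_gt0 ?pi_gt0.
have upS w : Delta <= `|w| -> ((charfun_abs P X w)%:E <= S)%E.
  by move=> Dw; apply: ereal_sup_ubound; exists w.
have S0 : (0 <= S)%E.
  apply: le_trans (upS Delta _); first by rewrite lee_fin sqrtr_ge0.
  by rewrite ger0_norm// ltW.
(* For infinite expectation the exponent is [-oo], so the left side is 0 and [S0] suffices. *)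
have [EXy|EX] := eqVneq 'E_P[X]%E +oo%E.
  by rewrite EXy gt0_muley ?lte_fin// gt0_mulye ?lte_fin.
have iX : P.-integrable setT (EFin \o X).
  apply/integrableP; split; first exact/measurable_EFinP.
  under eq_integral do rewrite /= ger0_norm//.
  by rewrite ltey; move: EX; rewrite expectation.unlock.
have EXE : 'E_P[X]%E = (\int[P]_w X w)%:E.
  by rewrite expectation.unlock fineK//; exact: integrable_fin_num.
rewrite EXE -!EFinM/=; set B := Delta * _ * _.
have B0 : 0 <= B.
  by rewrite mulr_ge0 ?(ltW pi2)// mulr_ge0 ?(ltW hDelta)// Rintegral_ge0.
rewrite leNgt; apply/negP => SB.
have Sfin : S \is a fin_num.
  by rewrite fin_numE -ltNye -ltey (lt_le_trans _ S0)// (lt_trans SB) ?ltry.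
move: SB S0 upS; rewrite -(fineK Sfin); set s := fine S.
rewrite !lte_fin !lee_fin => sB s0 upS.
(* A midpoint is positive even when [s = 0], so [- ln M] is a genuine decay rate, and it strictly
   exceeds [B]. *)
pose M := (s + expR (- B)) / 2.
have sM : s < M by rewrite /M; lra.
have MB : M < expR (- B) by rewrite /M; lra.
have M0 : 0 < M by exact: le_lt_trans sM.
have M1 : M <= 1 by rewrite (le_trans (ltW MB))// expR_le1 oppr_le0.
have lam0 : 0 <= - ln M by rewrite oppr_ge0 ln_le0.
have := decay_rate_le X0 iX lam0 hDelta.
rewrite opprK lnK ?posrE// -/B => H.
have : - ln M <= B.
  by apply: H => w Dw; rewrite (le_trans _ (ltW sM))// -lee_fin upS.
by rewrite leNgt ltrNr -[ltRHS]expRK ltr_ln ?posrE ?expR_gt0// MB.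
Qed.
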